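(* Let $n\ge2$ be an integer, $l>0$ and $0<\mu<n$. Let $\rho_\mu(t_1,\dots,t_n)=\langle\Delta x(t_1)\cdots\Delta x(t_n)\rangle$ be the $n$-point position auto-correlation function of the Fly-and-Die dynamics with parameters $l,\mu$, for times $t_1<t_2<\cdots<t_n$. Suppose all times tend to infinity in such a way that, for each $k=2,\dots,n$, the time lag $h_{k-1}=t_k-t_{k-1}$ is either fixed (independent of $t_1$) or satisfies $h_{k-1}\sim t_1^{q}$ for some $q<1$ (possibly depending on $k$). Then $$\rho_\mu(t_1,t_2,\dots,t_n)\sim\frac{n\,l}{n-\mu}\,t_1^{\,n-\mu}\qquad\text{as }t_1\to\infty.$$
   Context: Fly-and-Die dynamics with parameters $l>0$, $\mu>0$: for $x_0\in(0,1]$ let $t_c(x_0)=(l/x_0)^{1/\mu}$. The trajectory starting at $x_0$ is $x(x_0,t)=x_0+t$ for $0\le t\le t_c(x_0)$ and $x(x_0,t)=x_0+t_c(x_0)$ for $t\ge t_c(x_0)$. The displacement is $\Delta x(t)=x(x_0,t)-x_0$. The initial condition $x_0$ is uniformly distributed in $[0,1]$ and $\langle f\rangle=\int_0^1 f\,dx_0$. The symbol $A\sim B$ means $A/B\to1$. *)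

(* Defs.v *)
From HB Require Import structures.
From mathcomp Require Import all_boot all_order all_algebra.
From mathcomp Require Import all_classical all_reals all_analysis.
Set Implicit Arguments.
Unset Strict Implicit.
Unset Printing Implicit Defensive.
Import Order.TTheory GRing.Theory Num.Theory.
Import numFieldNormedType.Exports.
Local Open Scope classical_set_scope.
Local Open Scope ring_scope.

(* Meaningful for 0 < x0; at x0 = 0 the library conventions give a junk value,
   which only concerns a Lebesgue-null set of initial conditions. *)
Definition t_c (R : realType) (l mu x0 : R) : R := (l / x0) `^ (mu^-1).

(* Meaningful for times 0 <= t. *)
Definition trajectory (R : realType) (l mu x0 t : R) : R :=
  if t <= t_c l mu x0 then x0 + t else x0 + t_c l mu x0.

Definition displacement (R : realType) (l mu x0 t : R) : R :=
  trajectory l mu x0 t - x0.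

Definition average (R : realType) (f : R -> R) : R :=
  \int[@lebesgue_measure R]_(x0 in `[0, 1]) f x0.

Definition rho (R : realType) (n : nat) (l mu : R) (tau : 'I_n -> R) : R :=
  average (fun x0 => \prod_(i < n) displacement l mu x0 (tau i)).

Definition asymp_equiv (R : realType) (A B : R -> R) : Prop :=
  A s / B s @[s --> +oo] --> (1 : R).

(* A lag between consecutive times, as a function of the first time s. *)
Definition admissible_lag (R : realType) (h : R -> R) : Prop :=
  (exists c : R, \forall s \near +oo, h s = c) \/
  (exists2 q : R, q < 1 & asymp_equiv h (fun s => s `^ q)).

(* Main.v *)
Require Import Defs.
From HB Require Import structures.
From mathcomp Require Import all_boot all_order all_algebra.
From mathcomp Require Import all_classical all_reals all_analysis.
From mathcomp Require Import measurable_realfun.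
From mathcomp Require Import ring.
Import Order.TTheory GRing.Theory Num.Theory.
Import numFieldNormedType.Exports.
Local Open Scope classical_set_scope.
Local Open Scope ring_scope.

(* The displacement at time s is min(s, t_c(x0)), so rho is nondecreasing in
   each time.  When all times equal s, splitting [0, 1] at l s^(-mu), where
   t_c = s, gives the exact value C s^(n - mu) - D with C = n l / (n - mu) and
   a constant D.  Since every lag is o(t_1), the last time T satisfies
   T / t_1 -> 1, and rho is squeezed between its values with all times equal to
   t_1 and with all times equal to T. *)

(** * Displacement as a minimum, and its integrability *)

Lemma displacementE (R : realType) (l mu x s : R) :
  displacement l mu x s = Num.min s (t_c l mu x).
Proof.
rewrite /displacement /trajectory; case: leP => _; by rewrite addrC addKr.
Qed.

(** Separating the factor in [x] gives a form that is visibly measurable and can be integrated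
    explicitly. The library conventions make it hold at [x = 0] too. *)
Lemma t_cE (R : realType) (l mu x : R) : 0 <= l -> 0 <= x ->
  t_c l mu x = l `^ mu^-1 * x `^ (- mu^-1).
Proof.
move=> l0 x0; rewrite /t_c powRM ?invr_ge0//.
by rewrite -(powR_inv1 x0) -powRrM mulN1r.
Qed.

Lemma le_t_c (R : realType) (l mu s x : R) :
  0 <= l -> 0 < mu -> 0 < s -> 0 < x ->
  (s <= t_c l mu x) = (x <= l * s `^ (- mu)).
Proof.
move=> l0 mu0 s0 x0; have muV0 : 0 < mu^-1 by rewrite invr_gt0.
(* Writing [s] as the power [mu^-1] of [s^mu] makes both sides values of the same strictly
   increasing function, so their arguments can be compared. *)
rewrite /t_c -[s in LHS](powRr1 (ltW s0)) -(mulfV (lt0r_neq0 mu0)) powRrM.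
rewrite (le_mono_in (gt0_ltr_powR muV0))
  ?nnegrE ?powR_ge0 ?divr_ge0 ?(ltW x0)//.
by rewrite powRN ler_pdivlMr// ler_pdivlMr ?powR_gt0// mulrC.
Qed.

Lemma t_c_le (R : realType) (l mu s x : R) :
  0 <= l -> 0 < mu -> 0 < s -> 0 < x ->
  (t_c l mu x <= s) = (l * s `^ (- mu) <= x).
Proof.
move=> l0 mu0 s0 x0; have muV0 : 0 < mu^-1 by rewrite invr_gt0.
rewrite /t_c -[s in LHS](powRr1 (ltW s0)) -(mulfV (lt0r_neq0 mu0)) powRrM.
rewrite (le_mono_in (gt0_ltr_powR muV0))
  ?nnegrE ?powR_ge0 ?divr_ge0 ?(ltW x0)//.
by rewrite powRN ler_pdivrMr// ler_pdivrMr ?powR_gt0// mulrC.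
Qed.

(** Each factor lies between 0 and [tau i], so the product is bounded on a set of finite measure,
    whatever the singularity of [t_c] at 0. *)
Lemma prod_displacement_integrable (R : realType) (n : nat) (l mu : R)
    (tau : 'I_n -> R) : 0 <= l -> (forall i, 0 <= tau i) ->
  (@lebesgue_measure R).-integrable `[0, 1]
    (EFin \o (fun x => \prod_(i < n) displacement l mu x (tau i))).
Proof.
move=> l0 tau0; apply: measurable_bounded_integrable => //.
- by rewrite /= lebesgue_measure_itv /= lte_fin ltr01 -EFinB ltry.
- apply: measurable_prod => i _.
  apply: (eq_measurable_fun
    (fun x => Num.min (tau i) (l `^ mu^-1 * x `^ (- mu^-1)))).
    move=> x; rewrite inE /= in_itv /= => /andP[x0 _].
    by rewrite displacementE t_cE.
  apply: measurable_minr => //.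
  apply: measurable_funM => //; apply: measurable_funTS.
  exact: measurable_powR.
- exists (\prod_(i < n) tau i); split; first exact: num_real.
  move=> M ltM x /= _; apply: le_trans (ltW ltM).
  rewrite normr_prod; apply: ler_prod => i _.
  rewrite normr_ge0 displacementE ger0_norm ?ge_min ?lexx//.
  by rewrite le_min tau0 powR_ge0.
Qed.

Lemma ler_rho (R : realType) (n : nat) (l mu : R) (tau tau' : 'I_n -> R) :
  0 <= l -> (forall i, 0 <= tau i <= tau' i) -> rho l mu tau <= rho l mu tau'.
Proof.
move=> l0 tt; rewrite /rho /average; apply: le_Rintegral => //.
- by apply: prod_displacement_integrable => // i; case/andP: (tt i).
- apply: prod_displacement_integrable => // i; case/andP: (tt i).
  exact: le_trans.
- move=> x _; apply: ler_prod => i _; have /andP[t0 t1] := tt i.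
  rewrite !displacementE le_min t0 powR_ge0/=.
  by rewrite le_min !ge_min t1 lexx orbT.
Qed.

(** * Exact correlation at equal times *)

Lemma Rintegral_powR (R : realType) (a p : R) : 0 < a < 1 -> p != 1 ->
  \int[@lebesgue_measure R]_(x in `[a, 1]) x `^ (- p) =
    (1 - a `^ (1 - p)) / (1 - p).
Proof.
move=> /andP[a0 a1] p1.
have q0 : 1 - p != 0 by rewrite subr_eq0 eq_sym.
rewrite /Rintegral.
(* Since [0 < a], the antiderivative is smooth on the whole segment. *)
rewrite (@continuous_FTC2 _ _ (fun x => (1 - p)^-1 * x `^ (1 - p)))//=.
- by rewrite powR1 mulr1 mulrBl mul1r [_ / _]mulrC.
- apply: continuous_in_subspaceT => x; rewrite inE/= in_itv/= => /andP[ax _].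
  apply/differentiable_continuous/derivable1_diffP.
  by apply: derivable_powR; rewrite in_itv/= andbT (lt_le_trans a0).
- have dF x : 0 < x -> derivable (fun x : R => (1 - p)^-1 * x `^ (1 - p)) x 1.
    move=> x0; apply: derivableM => //.
    by apply: derivable_powR; rewrite in_itv/= andbT.
  have cF x : 0 < x ->
      {for x, continuous (fun x : R => (1 - p)^-1 * x `^ (1 - p))}.
    by move=> x0; apply/differentiable_continuous/derivable1_diffP/dF.
  split.
  + by move=> x; rewrite in_itv/= => /andP[ax _]; exact/dF/(lt_trans a0).
  + exact/cvg_at_right_filter/cF.
  + exact/cvg_at_left_filter/cF.
- move=> x; rewrite in_itv/= => /andP[ax _].
  have x0 : 0 < x by exact: lt_trans ax.
  rewrite derive1E deriveM//=; last first.
    by apply: derivable_powR; rewrite in_itv/= andbT.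
  rewrite derive_cst -derive1E powR_derive1 ?in_itv/= ?andbT// scaler0 addr0.
  by rewrite /GRing.scale/= mulrA mulVf// mul1r addrAC subrr sub0r.
Qed.

(** With [a = l s^(-mu)] and [p = n / mu], the integrand is [s^n] left of [a] and [l^p x^(-p)] right
    of it. The pieces contribute [l s^(n-mu)] and [(mu / (n-mu)) (l s^(n-mu) - l^p)]. *)
Lemma rho_cst (R : realType) (n : nat) (l mu s : R) :
  0 < l -> 0 < mu -> mu < n%:R -> 0 < s -> l * s `^ (- mu) < 1 ->
  rho l mu (fun _ : 'I_n => s) =
    n%:R * l / (n%:R - mu) * s `^ (n%:R - mu)
    - mu / (n%:R - mu) * l `^ (n%:R / mu).
Proof.
move=> l0 mu0 mun s0 a1; set a := l * _ in a1.
have a0 : 0 < a by rewrite mulr_gt0// powR_gt0.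
have intP : (@lebesgue_measure R).-integrable `[0, 1]
    (EFin \o (fun x => \prod_(i < n) displacement l mu x s)).
  by apply: prod_displacement_integrable => [|i]; exact: ltW.
have intS (D : set R) : measurable D -> D `<=` `[0, 1] ->
    (@lebesgue_measure R).-integrable D
    (EFin \o (fun x => \prod_(i < n) displacement l mu x s)).
  by move=> mD Dsub; apply: integrableS intP.
rewrite /rho /average.
have /(_ a) := @Rintegral_itvB R _ (BLeft 0) (BRight 1) _ intP.
rewrite !bnd_simp => /(_ (ltW a0) (ltW a1)) /eqP; rewrite subr_eq => /eqP ->.
have sub1 : `]a, 1] `<=` `[0 : R, 1].
  by move=> x; rewrite /= !in_itv/= => /andP[/ltW ax ->];
     rewrite (le_trans (ltW a0)).
have sub2 : `]0, a] `<=` `[0 : R, 1].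
  by move=> x; rewrite /= !in_itv/= => /andP[/ltW -> /le_trans ->//];
     exact: ltW.
(* Endpoints are null sets: [a] is added to the right piece to get a segment, and 0, where [t_c] has
   a default value, is removed from the left one. *)
rewrite Rintegral_itv_obnd_cbnd; last exact: intS.
rewrite -(Rintegral_itv_obnd_cbnd (r := 0)); last exact: intS.
have -> : \int[@lebesgue_measure R]_(x in `]0, a])
    (\prod_(i < n) displacement l mu x s) = s ^+ n * a.
  under eq_Rintegral => x.
    rewrite inE/= in_itv/= => /andP[x0 xa].
    rewrite displacementE (min_idPl _); last first.
      by rewrite le_t_c// ltW.
    rewrite prodr_const card_ord; over.
  rewrite Rintegral_cst//= lebesgue_measure_itv/= lte_fin a0 sube0//.
set p := n%:R / mu.
have p1 : 1 < p by rewrite ltr_pdivlMr// mul1r.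
have -> : \int[@lebesgue_measure R]_(x in `[a, 1])
    (\prod_(i < n) displacement l mu x s) =
    l `^ p * \int[@lebesgue_measure R]_(x in `[a, 1]) x `^ (- p).
  rewrite -RintegralZl//; last first.
    apply: continuous_compact_integrable; first exact: segment_compact.
    apply: continuous_in_subspaceT => x; rewrite inE/= in_itv/= => /andP[ax _].
    apply/differentiable_continuous/derivable1_diffP.
    by apply: derivable_powR; rewrite in_itv/= andbT (lt_le_trans a0).
  apply: eq_Rintegral => x; rewrite inE/= in_itv/= => /andP[ax _].
  have x0 : 0 < x by exact: lt_le_trans ax.
  rewrite displacementE (min_idPr _); last by rewrite t_c_le// ltW.
  rewrite prodr_const card_ord t_cE ?ltW// -powR_mulrn ?mulr_ge0 ?powR_ge0//.
  by rewrite powRM ?powR_ge0// -!powRrM mulNr [mu^-1 * _]mulrC.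
rewrite Rintegral_powR ?a0 ?gt_eqF//.
have -> : a `^ (1 - p) = l `^ (1 - p) * s `^ (n%:R - mu).
  rewrite /a powRM ?powR_ge0 ?ltW// -powRrM.
  by congr (_ * _ `^ _); rewrite /p; field; rewrite gt_eqF.
have -> : s ^+ n * a = l * s `^ (n%:R - mu).
  rewrite /a -powR_mulrn ?ltW// mulrCA -powRD//.
  by apply/implyP => _; rewrite gt_eqF.
have -> : l `^ (1 - p) = l / l `^ p.
  by rewrite powRB ?powRr1 ?(ltW l0)// (gt_eqF l0) implybT.
have L0 : l `^ p != 0 by rewrite gt_eqF// powR_gt0.
have h1 : n%:R - mu != 0 by rewrite subr_eq0 gt_eqF.
have h2 : mu - n%:R != 0 by rewrite subr_eq0 lt_eqF.
have h3 : mu != 0 by rewrite gt_eqF.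
(* With the powers made opaque, an identity of rational functions remains. *)
move: (l `^ p) L0 (s `^ _) => L L0 S; rewrite /p.
field; rewrite h1 h2 h3 L0//.
Qed.

(** * Limits as the first time tends to infinity *)

Lemma cvg_powRN_pinfty (R : realType) (a : R) : 0 < a ->
  s `^ (- a) @[s --> +oo] --> (0 : R).
Proof.
move=> a0; apply/cvgrPdist_lt => e e0; near=> s.
have s0 : 0 < s by near: s; exact: nbhs_pinfty_gt.
rewrite sub0r normrN ger0_norm ?powR_ge0// powRN.
rewrite -[e]invrK ltf_pV2 ?posrE ?invr_gt0 ?powR_gt0//.
(* The threshold for [s] is [(e^-1)^(a^-1)], whose power [a] is [e^-1]. *)
rewrite -[ltLHS](@powRr1) ?invr_ge0 ?(ltW e0)// -(mulVf (lt0r_neq0 a0)) powRrM.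
rewrite gt0_ltr_powR ?nnegrE ?powR_ge0 ?(ltW s0)//.
Unshelve. all: by end_near. Qed.

(** A fixed lag gives [c s^(-1)]; otherwise [h / s] is [h / s^q], which tends to 1, times
    [s^(-(1-q))], which tends to 0 as [q < 1]. *)
Lemma admissible_lag_small (R : realType) (h : R -> R) :
  admissible_lag h -> h s / s @[s --> +oo] --> (0 : R).
Proof.
case=> [[c hc]|[q q1 hq]].
  have : c * s `^ (- 1) @[s --> +oo] --> c * 0.
    by apply: cvgMr; apply: cvg_powRN_pinfty.
  rewrite mulr0; apply: cvg_trans; apply: near_eq_cvg; near=> s.
  have s0 : 0 <= s by near: s; exact: nbhs_pinfty_ge.
  by rewrite powR_inv1//; congr (_ / _); apply/esym; near: s.
have : h s / s `^ q * s `^ (- (1 - q)) @[s --> +oo] --> (1 * 0 : R).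
  by apply: cvgM => //; apply: cvg_powRN_pinfty; rewrite subr_gt0.
rewrite mulr0; apply: cvg_trans; apply: near_eq_cvg; near=> s.
have s0 : 0 < s by near: s; exact: nbhs_pinfty_gt.
rewrite opprB powRB ?powRr1 ?(ltW s0)//; last by rewrite (gt_eqF s0) implybT.
by rewrite mulrA divfK// gt_eqF// powR_gt0.
Unshelve. all: by end_near. Qed.

(** A general common time [T] serves both ends of the squeeze: the identity and the last time. *)
Lemma rho_cst_asymp (R : realType) (n : nat) (l mu : R) (T : R -> R) :
  0 < l -> 0 < mu -> mu < n%:R -> (\forall s \near +oo, s <= T s) ->
  T s / s @[s --> +oo] --> (1 : R) ->
  asymp_equiv (fun s => rho l mu (fun _ : 'I_n => T s))
    (fun s => n%:R * l / (n%:R - mu) * s `^ (n%:R - mu)).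
Proof.
move=> l0 mu0 mun leT T1; rewrite /asymp_equiv.
have a0 : 0 < n%:R - mu by rewrite subr_gt0.
have n0 : 0 < n%:R :> R by exact: lt_trans mun.
set D := mu / (n%:R - mu) * l `^ (n%:R / mu).
set C := n%:R * l / (n%:R - mu).
have C0 : C != 0 by rewrite gt_eqF// divr_gt0// mulr_gt0.
(* This is the quotient to be studied, once [rho_cst] applies. *)
have : (T s / s) `^ (n%:R - mu) - D / C * s `^ (- (n%:R - mu)) @[s --> +oo]
    --> (1 `^ (n%:R - mu) - D / C * 0 : R).
  apply: cvgB; last by apply: cvgMr; exact: cvg_powRN_pinfty.
  have powR_cont : {for 1, continuous (fun x : R => x `^ (n%:R - mu))}.
    apply/differentiable_continuous/derivable1_diffP.
    by apply: derivable_powR; rewrite in_itv/= andbT.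
  exact: (cvg_comp (fun s => T s / s) (fun x => x `^ (n%:R - mu)) T1 powR_cont).
rewrite powR1 mulr0 subr0; apply: cvg_trans; apply: near_eq_cvg; near=> s.
have s0 : 0 < s by near: s; exact: nbhs_pinfty_gt.
have sT : s <= T s by near: s.
have T0 : 0 < T s by exact: lt_le_trans sT.
rewrite rho_cst//; last first.
  (* The split point must fall below 1: [l T^(-mu) <= l s^(-mu) < 1] for large [s]. *)
  have : s `^ (- mu) < l^-1.
    near: s; apply: (cvgr_lt 0); first exact: cvg_powRN_pinfty.
    by rewrite invr_gt0.
  rewrite -[l^-1]mulr1 -ltr_pdivrMl ?invr_gt0// invrK.
  apply: le_lt_trans; rewrite ler_pM2l// !powRN lef_pV2 ?posrE ?powR_gt0//.
  by apply: ge0_ler_powR; rewrite ?nnegrE ?(ltW mu0) ?(ltW s0) ?(ltW T0).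
rewrite -/C -/D powRM ?invr_ge0 ?(ltW T0) ?(ltW s0)//.
rewrite -powR_inv1 ?(ltW s0)// -powRrM mulN1r powRN.
have S0 : s `^ (n%:R - mu) != 0 by rewrite gt_eqF// powR_gt0.
move: C D C0 => C D C0.
by field; rewrite C0 S0.
Unshelve. all: by end_near. Qed.

Lemma cvg_divff_pinfty (R : realType) : s / s @[s --> +oo] --> (1 : R).
Proof.
have : (fun=> 1 : R) @ (+oo : set_system R) --> (1 : R) by exact: cvg_cst.
apply: cvg_trans; apply: near_eq_cvg; near=> s.
have s0 : 0 < s by near: s; exact: nbhs_pinfty_gt.
by rewrite divff// gt_eqF.
Unshelve. all: by end_near. Qed.

(** By induction on the index: each step adds one lag divided by [s], which tends to 0. *)
Lemma time_asymp (R : realType) (n : nat) (t : 'I_n -> R -> R) :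
  (forall (i : 'I_n) (s : R), i = 0%N :> nat -> t i s = s) ->
  (forall i j : 'I_n, j = i.+1 :> nat ->
    admissible_lag (fun s => t j s - t i s)) ->
  forall i, t i s / s @[s --> +oo] --> (1 : R).
Proof.
move=> t_first t_lag [i]; elim: i => [|i IHi] ltin.
  rewrite (_ : (fun s => _) = (fun s => s / s)); first exact: cvg_divff_pinfty.
  by apply/funext => s; rewrite t_first.
pose i' := Ordinal (ltnW ltin); pose j := Ordinal ltin.
rewrite (_ : (fun s => _) = (fun s => t i' s / s + (t j s - t i' s) / s)).
  rewrite -[X in _ --> X]addr0.
  exact: cvgD (IHi _) (admissible_lag_small _ _ (t_lag i' j erefl)).
by apply/funext => s; rewrite -mulrDl addrC subrK.
Qed.

Theorem lemma5 (R : realType) (n : nat) (l mu : R) (t : 'I_n -> R -> R)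
  (n_ge2 : (2 <= n)%N) (l_gt0 : 0 < l) (mu_gt0 : 0 < mu) (mu_ltn : mu < n%:R)
  (t_first : forall (i : 'I_n) (s : R), i = 0%N :> nat -> t i s = s)
  (t_incr : \forall s \near +oo, forall i j : 'I_n, (i < j)%N -> t i s < t j s)
  (t_lag : forall i j : 'I_n, j = i.+1 :> nat ->
    admissible_lag (fun s => t j s - t i s)) :
  asymp_equiv (fun s => rho l mu (fun i => t i s))
    (fun s => n%:R * l / (n%:R - mu) * s `^ (n%:R - mu)).
Proof.
(* The successor form makes [ord0] and [ord_max] available as first and last index. *)
case: n => // n in t n_ge2 mu_ltn t_first t_incr t_lag *.
have t_mono : \forall s \near +oo, forall i j : 'I_n.+1,
    (i <= j)%N -> t i s <= t j s.
  near=> s => i j; rewrite leq_eqVlt => /predU1P[/val_inj->//|ij].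
  by apply/ltW; move: i j ij; near: s.
have last_ge : \forall s \near +oo, s <= t ord_max s.
  near=> s; rewrite -[leLHS](t_first ord0)//.
  have mono : forall i j : 'I_n.+1, (i <= j)%N -> t i s <= t j s by near: s.
  exact: mono.
have id_ge : \forall s \near +oo, s <= s :> R by near=> s.
have lower := rho_cst_asymp _ n.+1 l mu id l_gt0 mu_gt0 mu_ltn id_ge
  (cvg_divff_pinfty R).
have upper := rho_cst_asymp _ n.+1 l mu (t ord_max) l_gt0 mu_gt0 mu_ltn last_ge
  (time_asymp _ _ _ t_first t_lag _).
apply: (squeeze_cvgr _ lower upper).
near=> s.
have s0 : 0 < s by near: s; exact: nbhs_pinfty_gt.
have mono : forall i j : 'I_n.+1, (i <= j)%N -> t i s <= t j s by near: s.
have ge_s i : s <= t i s by rewrite -[leLHS](t_first ord0)// mono.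
have B0 : 0 < (n.+1%:R * l / (n.+1%:R - mu) * s `^ (n.+1%:R - mu))^-1.
  by rewrite invr_gt0 mulr_gt0 ?powR_gt0// divr_gt0 ?subr_gt0//
    mulr_gt0// ltr0n.
(* After cancelling the positive denominator, both bounds are monotonicity of [rho], as
   [s <= t i s <= t ord_max s]. *)
rewrite !(ler_pM2r B0); apply/andP; split; apply: ler_rho => [|i];
  rewrite ?(ltW l_gt0)//.
  by rewrite (ltW s0) ge_s.
by rewrite (le_trans (ltW s0) (ge_s i)) mono// -ltnS.
Unshelve. all: by end_near. Qed.
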